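(* Let $d\ge1$, $\sigma>0$, and let $\epsilon\in\Big(1-\big(1-2Q\big(\tfrac1{2\sigma}\big)\big)^d,\,1\Big)$. Set $$k_\star=\left\lfloor\frac{1}{\sigma\,Q^{-1}\Big(\tfrac12\big(1-(1-\epsilon)^{1/d}\big)\Big)}\right\rfloor .$$ Then $k_\star\ge2$ and, for every $n\in\mathbb{N}$, $$\sup_{P\in\mathcal{F}_d}\Big|h(P\ast\mathcal{N}_\sigma)-\mathbb{E}_{P^{\otimes n}}h(\hat P_{S^n}\ast\mathcal{N}_\sigma)\Big|\ge\log\left(\frac{k_\star^{d(1-\epsilon)}}{n}\right)-H_b(\epsilon).$$ Consequently, for any given $\delta>0$, the left-hand side (the bias) cannot be less than $\delta$ so long as $n\le k_\star^{d(1-\epsilon)}\,e^{-(\delta+H_b(\epsilon))}$.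
   Context: $\mathcal{F}_d$ is the class of all probability distributions $P$ on $\mathbb{R}^d$ with $\mathrm{supp}(P)\subseteq[-1,1]^d$. $\mathcal{N}_\sigma=\mathcal{N}(0,\sigma^2\mathrm{I}_d)$; $S^n=(S_1,\dots,S_n)\sim P^{\otimes n}$; $\hat P_{S^n}=\frac1n\sum_{i=1}^n\delta_{S_i}$; $\ast$ is convolution of measures; $h(\cdot)$ is differential entropy; logarithms are natural. $Q(x)=\frac1{\sqrt{2\pi}}\int_x^\infty e^{-t^2/2}dt$ and $Q^{-1}$ is its inverse. $H_b(\alpha)=-\alpha\log\alpha-(1-\alpha)\log(1-\alpha)$ is the binary entropy. *)

(* Defs.v *)
From HB Require Import structures.
From mathcomp Require Import all_boot all_order all_algebra.
From mathcomp Require Import all_classical all_reals all_analysis.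
From mathcomp Require Import measurable_realfun.

Set Implicit Arguments.
Unset Strict Implicit.
Unset Printing Implicit Defensive.

Import Order.TTheory GRing.Theory Num.Theory.
Import numFieldNormedType.Exports.

Local Open Scope classical_set_scope.
Local Open Scope ring_scope.

Section power_measure.
Local Open Scope ereal_scope.
Context {disp : measure_display} {T : measurableType disp} {R : realType}.

Definition tcons n (p : T * n.-tuple T) : n.+1.-tuple T := cons_tuple p.1 p.2.

Lemma measurable_tcons n : measurable_fun [set: T * n.-tuple T] (@tcons n).
Proof. exact: (measurable_cons measurable_fst measurable_snd). Qed.

(* The n-fold product measure mu \x ... \x mu. It is defined on bare set
   functions so that the same constant gives Lebesgue measure on R^d, the
   isotropic Gaussian, and the law of an i.i.d. sample; the instances below
   show that it is a sigma-finite (resp. probability) measure if mu is. *)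
Fixpoint power_measure (mu : set T -> \bar R) (n : nat) :
    set (n.-tuple T) -> \bar R :=
  match n with
  | 0 => \d_([tuple] : 0.-tuple T)
  | m.+1 => pushforward (mu \x @power_measure mu m) (@tcons m)
  end.
Arguments power_measure mu n : clear implicits.

Section sigma_finite.
Variable mu : {sigma_finite_measure set T -> \bar R}.

Let power_measureP n : exists m : {sigma_finite_measure set (n.-tuple T) -> \bar R},
  power_measure mu n = m :> (set _ -> _).
Proof.
elim: n => [|n [m IH]].
  by exists (\d_([tuple] : 0.-tuple T)).
pose pf : {measure set (n.+1.-tuple T) -> \bar R} :=
  measure_function_pushforward__canonical__measure_function_Measure (mu \x m)
    (@measurable_tcons n).
have sf : sigma_finite setT pf.
  have /sigma_finiteP[F [FT ndF Foo]] := sigma_finiteT mu.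
  have /sigma_finiteP[G [GT ndG Goo]] := sigma_finiteT m.
  pose g (t : n.+1.-tuple T) := (thead t, [tuple of behead t]).
  have gK : cancel (@tcons n) g.
    by move=> [x t]; rewrite /g /tcons theadE; congr pair; exact: val_inj.
  have mg : measurable_fun setT g.
    apply/measurable_fun_pairP; split; last exact: measurable_behead.
    exact: (measurable_tnth ord0).
  exists (fun k => g @^-1` (F k `*` G k)).
    apply/esym; rewrite -subTset => t _.
    have [i _ Fi] : (\bigcup_k F k) (thead t) by rewrite -FT.
    have [j _ Gj] : (\bigcup_k G k) [tuple of behead t] by rewrite -GT.
    exists (maxn i j) => //; split => /=.
    - by move: Fi; exact/subsetPset/ndF/leq_maxl.
    - by move: Gj; exact/subsetPset/ndG/leq_maxr.
  move=> k; have [mF Fk] := Foo k; have [mG Gk] := Goo k; split.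
    rewrite -[X in measurable X]setTI; apply: mg => //; exact: measurableX.
  rewrite /pf /= /pushforward -comp_preimage.
  rewrite (_ : g \o @tcons n = id); last by apply/funext => p; exact: gK.
  by rewrite preimage_id product_measure1E// lte_mul_pinfty// ge0_fin_numE.
pose build := Measure_isSigmaFinite.Build _ _ _ (pf : set _ -> _) sf.
pose M : {sigma_finite_measure set (n.+1.-tuple T) -> \bar R} :=
  HB.pack (Measure.sort pf) (Measure.class pf) build.
by exists M; rewrite /= IH.
Qed.

Variable n : nat.

Let power0 : power_measure mu n set0 = 0.
Proof. by have [m ->] := power_measureP n; exact: measure0. Qed.

Let power_ge0 A : 0 <= power_measure mu n A.
Proof. by have [m ->] := power_measureP n; exact: measure_ge0. Qed.

Let power_sigma_additive : semi_sigma_additive (power_measure mu n).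
Proof.
by have [m ->] := power_measureP n; exact: measure_semi_sigma_additive.
Qed.

HB.instance Definition _ := isMeasure.Build _ _ _
  (power_measure mu n) power0 power_ge0 power_sigma_additive.

Let power_sigma_finite : sigma_finite setT (power_measure mu n).
Proof. by have [m ->] := power_measureP n; exact: sigma_finiteT. Qed.

HB.instance Definition _ := Measure_isSigmaFinite.Build _ _ _
  (power_measure mu n) power_sigma_finite.

End sigma_finite.

Section probability.
Variables (P : probability T R) (n : nat).

Let power_setT : power_measure P n setT = 1.
Proof.
elim: n => [|m IH]; first by rewrite /= diracT.
rewrite [LHS]/= /pushforward preimage_setT -setXTT.
rewrite product_measure1E// -[RHS]mule1; congr (_ * _); last exact: IH.
exact: probability_setT.
Qed.

HB.instance Definition _ := Measure_isProbability.Build _ _ _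
  (power_measure P n) power_setT.

End probability.

End power_measure.
Arguments tcons {disp T n}.
Arguments power_measure {disp T R} mu n _.

(* R^d carries the product of the Borel sigma-algebras of R, i.e. its Borel
   sigma-algebra. *)
Notation Rvec R d := (d.-tuple (measurableTypeR R)).

Section vectors.
Context {R : realType} {d : nat}.
Implicit Types x y : Rvec R d.

Definition addv x y : Rvec R d :=
  [tuple (tnth x i : R) + (tnth y i : R) | i < d].

Lemma measurable_addv :
  measurable_fun [set: Rvec R d * Rvec R d] (fun p => addv p.1 p.2).
Proof.
apply/measurable_fun_tnthP => i.
rewrite (_ : _ \o _ = (fun p : Rvec R d * Rvec R d =>
  (tnth p.1 i : R) + (tnth p.2 i : R))); last first.
  by apply/funext => p /=; rewrite tnth_mktuple.
apply: measurable_funD.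
- apply: (measurableT_comp (measurable_tnth i)); exact: measurable_fst.
- apply: (measurableT_comp (measurable_tnth i)); exact: measurable_snd.
Qed.

(* Open ball of the sup norm. *)
Definition cubev x (r : R) : set (Rvec R d) :=
  [set y | forall i, `|(tnth y i : R) - (tnth x i : R)| < r].

(* The (closed) support: the points all of whose neighbourhoods are charged. *)
Definition supp (P : set (Rvec R d) -> \bar R) : set (Rvec R d) :=
  [set x | forall r : R, 0 < r -> (0 < P (cubev x r))%E].

Definition unit_cube : set (Rvec R d) :=
  [set x | forall i, -1 <= (tnth x i : R) <= 1].

Definition lebesgue_vec : set (Rvec R d) -> \bar R :=
  power_measure (@lebesgue_measure R) d.
HB.instance Definition _ := SigmaFiniteMeasure.on lebesgue_vec.

(* N(0, sigma^2 I_d): d independent coordinates of law N(0, sigma^2). The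
   second argument of normal_prob is the standard deviation. *)
Definition gaussian_vec (sigma : R) : set (Rvec R d) -> \bar R :=
  power_measure (normal_prob 0 sigma) d.
HB.instance Definition _ sigma := Measure.on (gaussian_vec sigma).
HB.instance Definition _ sigma := Probability.on (gaussian_vec sigma).

Definition convolution (P Q : set (Rvec R d) -> \bar R) :
    set (Rvec R d) -> \bar R :=
  pushforward (P \x Q)%E (fun p => addv p.1 p.2).

(* For n = 0 this is the zero measure. *)
Definition empirical n (s : n.-tuple (Rvec R d)) : set (Rvec R d) -> \bar R :=
  fun A => ((n%:R^-1)%:E * \sum_(i < n) \d_(tnth s i) A)%E.

End vectors.

Section convolution_finite.
Local Open Scope ereal_scope.
Context {R : realType} {d : nat}.
Variables P Q : {finite_measure set (Rvec R d) -> \bar R}.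

Let conv0 : convolution P Q set0 = 0.
Proof. by rewrite /convolution /pushforward preimage_set0 measure0. Qed.

Let conv_ge0 A : 0 <= convolution P Q A.
Proof. by rewrite /convolution /pushforward; exact: measure_ge0. Qed.

Let conv_sigma_additive : semi_sigma_additive (convolution P Q).
Proof.
exact: (@measure_semi_sigma_additive _ _ _
  (measure_function_pushforward__canonical__measure_function_Measure
     (P \x Q) measurable_addv)).
Qed.

HB.instance Definition _ := isMeasure.Build _ _ _
  (convolution P Q) conv0 conv_ge0 conv_sigma_additive.

Let conv_fin : fin_num_fun (convolution P Q).
Proof.
apply: lty_fin_num_fun.
rewrite [X in X < _](_ : _ = P setT * Q setT).
  by rewrite -ge0_fin_numE ?mule_ge0// fin_numM// fin_num_measure.
rewrite -product_measure1E// setXTT.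
by [].
Qed.

HB.instance Definition _ := Measure_isFinite.Build _ _ _
  (convolution P Q) conv_fin.

End convolution_finite.

Section empirical_finite.
Local Open Scope ereal_scope.
Context {R : realType} {d n : nat}.
Variable s : n.-tuple (Rvec R d).

Let m : {measure set (Rvec R d) -> \bar R} :=
  mscale (NngNum (ltac:(by rewrite invr_ge0) : (0 <= n%:R^-1 :> R)%R))
    (msum (fun k => \d_(nth (nseq_tuple d 0%R : Rvec R d) s k)) n).

Let empiricalE : empirical s = m :> (set _ -> _).
Proof.
apply/funext => A; rewrite /empirical /m /= /mscale /msum /=; congr (_ * _).
by apply: eq_bigr => i _; rewrite (tnth_nth (nseq_tuple d 0%R : Rvec R d)).
Qed.

Let emp0 : empirical s set0 = 0.
Proof. by rewrite empiricalE measure0. Qed.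

Let emp_ge0 A : 0 <= empirical s A.
Proof. by rewrite empiricalE measure_ge0. Qed.

Let emp_sigma_additive : semi_sigma_additive (empirical s).
Proof. by rewrite empiricalE; exact: measure_semi_sigma_additive. Qed.

HB.instance Definition _ := isMeasure.Build _ _ _
  (empirical s) emp0 emp_ge0 emp_sigma_additive.

Let emp_fin : fin_num_fun (empirical s).
Proof.
move=> A mA; rewrite /empirical fin_numM// sum_fin_num.
by apply/allP => ? /mapP[i _ ->]; exact: fin_num_measure.
Qed.

HB.instance Definition _ := Measure_isFinite.Build _ _ _
  (empirical s) emp_fin.

End empirical_finite.

Section entropy.
Context {R : realType} {d : nat}.
Local Open Scope charge_scope.

(* Differential entropy - \int f ln f, where f is the Lebesgue density of mu
   (with ln 0 = 0, hence 0 ln 0 = 0); -oo if mu has no density. *)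
Definition entropy (mu : {finite_measure set (Rvec R d) -> \bar R}) : \bar R :=
  if `[< mu `<< lebesgue_vec >] then
    let f x := fine (('d (charge_of_finite_measure mu) '/d lebesgue_vec) x) in
    (- \int[lebesgue_vec]_x (f x * ln (f x))%:E)%E
  else -oo%E.

Definition bias (sigma : R) (n : nat) (P : probability (Rvec R d) R) : \bar R :=
  (entropy (convolution P (gaussian_vec sigma)) -
   \int[power_measure P n]_s
      entropy (convolution (empirical s) (gaussian_vec sigma)))%E.

Definition sup_bias (sigma : R) (n : nat) : \bar R :=
  ereal_sup [set `|bias sigma n P|%E |
    P in [set P : probability (Rvec R d) R | supp P `<=` unit_cube]].

End entropy.
Arguments sup_bias {R} d sigma n.

Section scalar.
Context {R : realType}.
Implicit Types x p a eps sigma : R.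

Definition Qfun x : R := (Num.sqrt (2 * pi))^-1 *
  \int[lebesgue_measure]_(t in `[x, +oo[) expR (- t ^+ 2 / 2).

(* Q is a decreasing bijection from R onto ]0, 1[; the default value 0 is only
   used outside this interval. *)
Definition Qinv p : R := xget 0 [set x | Qfun x = p].

Definition binary_entropy a : R := - a * ln a - (1 - a) * ln (1 - a).

Definition kstar (d : nat) sigma eps : int :=
  Num.floor (sigma * Qinv (2^-1 * (1 - (1 - eps) `^ d%:R^-1)))^-1.

End scalar.

(* Main.v *)
From HB Require Import structures.
From mathcomp Require Import all_boot all_order all_algebra.
From mathcomp Require Import all_classical all_reals all_analysis.
From mathcomp Require Import measurable_realfun ring lra.
Require Import Defs.

(** Why the theorem holds.  Write q for the number with
    (1 - 2 Q(q))^d = 1 - eps.  The hypothesis on eps says exactly that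
    0 < sigma q < 1/2, whence k = floor (1 / (sigma q)) >= 2 and
    sigma q <= 1/k.  Cut [-1, 1]^d into M = k^d cubes of half side 1/k and let
    P be uniform on their centres.  A point S of law P is then recovered from
    S + Z, with Z a Gaussian vector, as the centre whose cube of half side
    sigma q contains S + Z, and this succeeds with probability exactly
    (1 - 2 Q(q))^d = 1 - eps.

    Two bounds on the entropy of a Gaussian mixture, i.e. of the uniform
    distribution on n points convolved with the Gaussian, give the result.
    - Upper bound, [entropy_mixture_le]: for every choice of the n points the
      entropy is at most h(N) + ln n, because the mixture density is at least
      1/n times each of its components.  It applies to every realisation of
      the empirical measure, hence to the expectation.
    - Lower bound, [entropy_mixture_ge]: if the cubes are disjoint, the entropy
      for M points is at least h(N) + (1 - eps) ln M - H_b(eps).  This is Fano's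
      inequality, obtained here in its variational form.  The mutual
      information of S and S + Z is at least ln M + E [ln a_S(S + Z)] for any
      positive functions a_i of the observation with sum at most 1; the
      choice is a_i = 1 - eps on the i-th cube and eps / M elsewhere.
    The difference of the two bounds is the claim, and h(N) cancels.

    Both bounds come from pointwise inequalities between integrands
    ([mean_xlnx_ge] and [mean_xlnx_le], the log-sum inequality), so that the
    only integrals needed are those of p (ln p - c - c' 1_cube) for a
    single shifted Gaussian density p ([integral_gauss_ln]). *)

Set Implicit Arguments.
Unset Strict Implicit.
Unset Printing Implicit Defensive.

Import Order.TTheory GRing.Theory Num.Theory.
Import numFieldNormedType.Exports.

Local Open Scope classical_set_scope.
Local Open Scope ring_scope.

(** * Affine changes of variable and Gaussian tails on the line *)

Section affine.
Context {R : realType}.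
Notation mu := (@lebesgue_measure R).
Implicit Types (b c m s x y q : R).

Local Notation affine c b :=
  ((fun t => c * t + b) : measurableTypeR R -> measurableTypeR R).

Lemma measurable_affine c b : measurable_fun setT (affine c b).
Proof. by apply: measurable_funD => //; apply: measurable_funM. Qed.

(** Both sides are measures in A, so it is enough to compare them on
    half-open intervals; the sign of c decides which end of the preimage is
    closed. *)
Lemma lebesgue_measure_affine c b (A : set (measurableTypeR R)) : c != 0 ->
  measurable A -> mu A = (`|c|%:E * mu (affine c b @^-1` A))%E.
Proof.
move=> c0 mA.
pose pf : {measure set (measurableTypeR R) -> \bar R} :=
  measure_function_pushforward__canonical__measure_function_Measure mu
    (measurable_affine c b).
rewrite (@lebesgue_measure_unique _ (mscale (NngNum (normr_ge0 c)) pf))//.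
move=> _ [[u v]] _ <-; rewrite /= /mscale/= /pushforward.
have [c_gt0|c_le0] := ltP 0 c.
  rewrite (_ : _ @^-1` _ = `](u - b) / c, (v - b) / c]%classic); last first.
    apply/seteqP; split => t /=; rewrite !in_itv/=.
      by move=> /andP[h1 h2]; rewrite ltr_pdivrMr// ler_pdivlMr//; apply/andP; split; lra.
    by rewrite ltr_pdivrMr// ler_pdivlMr// => /andP[h1 h2]; apply/andP; split; lra.
  rewrite !lebesgue_measure_itv/= !lte_fin ltr_pM2r ?invr_gt0// ltrBlDr subrK.
  case: ifPn => uv; last by rewrite mule0.
  rewrite -!EFinB -EFinM gtr0_norm//; congr EFin; field.
  by rewrite gt_eqF.
have c_lt0 : c < 0 by rewrite lt_neqAle c0.
rewrite (_ : _ @^-1` _ = `[(v - b) / c, (u - b) / c[%classic); last first.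
  apply/seteqP; split => t /=; rewrite !in_itv/=.
    by move=> /andP[h1 h2]; rewrite ler_ndivrMr// ltr_ndivlMr//; apply/andP; split; lra.
  by rewrite ler_ndivrMr// ltr_ndivlMr// => /andP[h1 h2]; apply/andP; split; lra.
rewrite !lebesgue_measure_itv/= !lte_fin ltr_nM2r ?invr_lt0// ltrBlDr subrK.
case: ifPn => uv; last by rewrite mule0.
rewrite -!EFinB -EFinM ltr0_norm//; congr EFin; field.
by rewrite lt_eqF.
Qed.

Lemma ge0_integral_affine c b (D : set (measurableTypeR R))
    (f : measurableTypeR R -> \bar R) :
  c != 0 -> measurable D -> measurable_fun D f ->
  (forall x, D x -> 0 <= f x)%E ->
  (\int[mu]_(x in D) f x =
   `|c|%:E * \int[mu]_(t in affine c b @^-1` D) f (c * t + b)%R)%E.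
Proof.
move=> c0 mD mf f0.
pose pf : {measure set (measurableTypeR R) -> \bar R} :=
  measure_function_pushforward__canonical__measure_function_Measure mu
    (measurable_affine c b).
rewrite (@eq_measure_integral _ _ _ _ (mscale (NngNum (normr_ge0 c)) pf)); last first.
  by move=> A mA _; rewrite /= /mscale/=; exact: (lebesgue_measure_affine b).
rewrite ge0_integral_mscale//=; congr (_ * _)%E.
rewrite ge0_integral_pushforward//; first exact: measurable_affine.
by move=> x; rewrite inE; exact: f0.
Qed.
End affine.

Section gaussian_tail.
Context {R : realType}.
Notation mu := (@lebesgue_measure R).
Implicit Types (p q s x y : R).

Lemma normal_pdf_scale s x : 0 < s ->
  s * normal_pdf 0 s (s * x) = (Num.sqrt (2 * pi))^-1 * expR (- x ^+ 2 / 2).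
Proof.
move=> s0; rewrite normal_pdfE ?gt_eqF// /normal_peak /normal_fun subr0.
rewrite mulrA; congr (_ * expR _).
  rewrite -mulr_natl mulrCA sqrtrM ?sqr_ge0// sqrtr_sqr gtr0_norm// invfM mulrA.
  by rewrite divff ?gt_eqF// mul1r.
by rewrite -mulr_natl; field; rewrite gt_eqF.
Qed.

(** Rescaling by s turns the tail of N(0, s^2) beyond s * x into the standard
    tail beyond x. *)
Lemma normal_prob_Qfun s x : 0 < s ->
  normal_prob 0 s `[s * x, +oo[ = (Qfun x)%:E.
Proof.
move=> s0; have s_neq0 : s != 0 by rewrite gt_eqF.
have mpdf : measurable_fun setT (fun t => (normal_pdf 0 s t)%:E).
  by apply/measurable_EFinP; exact: measurable_normal_pdf.
have int_pdf : mu.-integrable setT (fun t => (normal_pdf 0 s (s * t))%:E).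
  apply/integrableP; split.
    by apply: (measurableT_comp mpdf) => //; apply: measurable_funM.
  under eq_integral do rewrite gee0_abs ?lee_fin ?normal_pdf_ge0//.
  have int1 := integral_normal_pdf 0 s.
  rewrite (@ge0_integral_affine _ s 0)// in int1; last first.
    by move=> t _; rewrite lee_fin normal_pdf_ge0.
  move: int1; rewrite preimage_setT.
  under [X in (_ * X)%E = _ -> _]eq_integral do rewrite addr0.
  move: (\int[mu]_t _)%E => [r||//]; first by rewrite ltry.
  by rewrite gt0_muley// lte_fin normr_gt0.
rewrite /normal_prob (@ge0_integral_affine _ s 0)//; last first.
- by move=> t _; rewrite lee_fin normal_pdf_ge0.
- exact: measurable_funTS.
rewrite (_ : _ @^-1` _ = `[x, +oo[%classic); last first.
  by apply/seteqP; split=> t /=; rewrite !in_itv/= !andbT addr0 ler_pM2l.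
under eq_integral do rewrite addr0.
have fin_int : (\int[mu]_(t in `[x, +oo[) (normal_pdf 0 s (s * t))%:E)%E \is a fin_num.
  apply: integrable_fin_num => //.
  exact: integrableS int_pdf.
rewrite -(fineK fin_int) -EFinM gtr0_norm//; congr EFin.
rewrite -[fine _]/(\int[mu]_(t in `[x, +oo[) (normal_pdf 0 s (s * t))).
rewrite -RintegralZl//=; last exact: integrableS int_pdf.
rewrite /Qfun -RintegralZl//=.
  by apply: eq_Rintegral => t _; rewrite normal_pdf_scale.
have h : mu.-integrable `[x, +oo[ (fun t => (Num.sqrt (2 * pi) * s)%:E * (normal_pdf 0 s (s * t))%:E)%E.
  by apply: integrableZl => //; exact: integrableS int_pdf.
apply: (eq_integrable _ _ _ _ h) => //= t _.
rewrite -EFinM -mulrA normal_pdf_scale// mulrA divff ?mul1r//.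
by rewrite gt_eqF// sqrtr_gt0 mulr_gt0// pi_gt0.
Qed.

Lemma normal_prob_Qfun_left s x : 0 < s ->
  normal_prob 0 s `]-oo, - (s * x)[ = (Qfun x)%:E.
Proof.
move=> s0; rewrite -(@normal_prob_Qfun s)// /normal_prob.
have mpdf : measurable_fun setT (fun t => (normal_pdf 0 s t)%:E).
  by apply/measurable_EFinP; exact: measurable_normal_pdf.
rewrite (@ge0_integral_affine _ (-1) 0)//; last first.
- by move=> t _; rewrite lee_fin normal_pdf_ge0.
- exact: measurable_funTS.
rewrite normrN1 mul1e (_ : _ @^-1` _ = `]s * x, +oo[%classic); last first.
  by apply/seteqP; split=> t /=; rewrite !in_itv/= !andbT addr0 mulN1r ltrN2.
rewrite -[RHS]integral_itv_obnd_cbnd//; last exact: measurable_funTS.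
apply: eq_integral => t _; congr EFin.
rewrite addr0 mulN1r !normal_pdfE ?gt_eqF// /normal_fun !subr0.
by rewrite sqrrN.
Qed.

(** The interval is half-open so that it and the two tails partition the line
    even when x = 0, which is the case that yields Q(0) = 1/2. *)
Lemma normal_prob_itv s x : 0 < s -> 0 <= x ->
  normal_prob 0 s `[- (s * x), s * x[ = (1 - 2 * Qfun x)%:E.
Proof.
move=> s0 x0.
have : normal_prob 0 s setT = 1%E by exact: probability_setT.
have sx0 : 0 <= s * x by rewrite mulr_ge0// ltW.
rewrite (_ : setT = `]-oo, - (s * x)[ `|`
    (`[- (s * x), s * x[ `|` `[s * x, +oo[))%classic; last first.
  apply/esym; rewrite -subTset => t _ /=; rewrite !in_itv/= andbT.
  have [tsx|] := ltP t (- (s * x)); first by left.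
  by move=> ?; right; have [tsx|] := leP (s * x) t; [right|left].
rewrite !measureU//=; first last.
- rewrite -subset0 => t /= []; rewrite !in_itv/= andbT => h1 [/andP[h2 h3]|h2]; lra.
- exact: measurableU.
- rewrite -subset0 => t /= []; rewrite !in_itv/= andbT => /andP[]; lra.
rewrite normal_prob_Qfun// normal_prob_Qfun_left//.
rewrite -(@fineK _ (normal_prob 0 s `[_, _[)) ?fin_num_measure//.
by move=> [] h; congr EFin; lra.
Qed.

Lemma Qfun0 : Qfun 0 = 2^-1 :> R.
Proof.
have := @normal_prob_itv 1 0 ltr01 (lexx _).
rewrite mul1r oppr0 set_itv_ge ?bnd_simp ?ltxx// measure0 => -[]; lra.
Qed.

Lemma Qfun_ge0 x : 0 <= Qfun x.
Proof. by rewrite -lee_fin -(@normal_prob_Qfun 1)// measure_ge0. Qed.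

Lemma Qfun_nincr x y : x <= y -> Qfun y <= Qfun x.
Proof.
move=> xy; rewrite -lee_fin -!(@normal_prob_Qfun 1)// !mul1r le_measure ?inE//.
by move=> t /=; rewrite !in_itv/= !andbT; exact: le_trans.
Qed.

Lemma Qfun_lipschitz x y : x <= y ->
  Qfun x - Qfun y <= normal_peak 1 * (y - x).
Proof.
move=> xy; rewrite lerBlDr -lee_fin EFinD -!(@normal_prob_Qfun 1)// !mul1r.
rewrite (_ : `[x, +oo[ = `[x, y[ `|` `[y, +oo[)%classic; last first.
  apply/seteqP; split => t /=; rewrite !in_itv/= !andbT.
    by move=> ->; have [ty|] := leP y t; [right|left].
  by case=> [/andP[]//|]; exact: le_trans.
rewrite measureU//=; last first.
  rewrite -subset0 => t /= []; rewrite !in_itv/= andbT => /andP[]; lra.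
rewrite leeD2r// /normal_prob.
apply: (@le_trans _ _ (\int[mu]_(t in `[x, y[) (cst (normal_peak 1)%:E t))%E).
  apply: ge0_le_integral => //.
  - by move=> t _; rewrite lee_fin normal_pdf_ge0.
  - by apply/measurable_EFinP/measurable_funTS; exact: measurable_normal_pdf.
  - by move=> t _; rewrite lee_fin normal_pdf_ub.
rewrite integral_cst//= lebesgue_measure_itv/= lte_fin; case: ifPn => //.
by rewrite mule0 lee_fin mulr_ge0 ?normal_peak_ge0// subr_ge0.
Qed.

Lemma continuous_Qfun : continuous (@Qfun R).
Proof.
have Qdist x y : `|Qfun x - Qfun y| <= normal_peak 1 * `|x - y|.
  wlog xy : x y / x <= y.
    by move=> h; have [/h//|/ltW/h] := leP x y; rewrite !(distrC y) (distrC (Qfun y)).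
  rewrite (distrC x) !ger0_norm ?subr_ge0//; last exact: Qfun_nincr.
  exact: Qfun_lipschitz.
have c0 : 0 < normal_peak (1 : R) by rewrite normal_peak_gt0.
move=> x; apply/cvgrPdist_lt => e e0; near=> y.
apply: le_lt_trans (Qdist x y) _.
rewrite mulrC -ltr_pdivlMr//; near: y.
apply: cvgr_dist_lt => //; exact: divr_gt0.
Unshelve. all: by end_near. Qed.

(** By the intermediate value theorem on [0, y], p is a value of Q, so the
    choice in the definition of Qinv returns a preimage of p. *)
Lemma QinvK p y : 0 <= y -> Qfun y <= p -> p <= 2^-1 -> Qfun (Qinv p) = p.
Proof.
move=> y0 yp p2; rewrite /Qinv; case: xgetP => [? -> //|/=].
have [||c _ cp] := @IVT R Qfun 0 y p y0 => //.
- by apply: continuous_subspaceT => x; exact: continuous_Qfun.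
- by rewrite Qfun0 min_r ?max_l// ?yp//; apply: le_trans yp p2.
by move=> /(_ c)/=.
Qed.

End gaussian_tail.

(** * Densities and iterated integrals *)

Section density.
Local Open Scope ereal_scope.
Context {disp : measure_display} {T : measurableType disp} {R : realType}.
Variables (nu : {finite_measure set T -> \bar R})
  (mu : {sigma_finite_measure set T -> \bar R}) (g : T -> R).
Hypothesis mg : measurable_fun setT g.
Hypothesis nuE : forall A, measurable A -> nu A = \int[mu]_(x in A) (g x)%:E.

Lemma density_dominates : nu `<< mu.
Proof.
apply/null_content_dominatesP => A mA muA0; rewrite nuE//.
apply: null_set_integral => //.
by apply/measurable_funTS/measurable_EFinP.
Qed.

Lemma density_ae_eq (f : T -> \bar R) :
  mu.-integrable setT f ->
  (forall A, measurable A -> nu A = \int[mu]_(x in A) f x) ->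
  ae_eq mu setT f (EFin \o g).
Proof.
move=> intf nuf; apply: integral_ae_eq => //; first exact/measurable_EFinP.
by move=> A _ mA; rewrite -nuf// nuE.
Qed.

(** The Radon-Nikodym derivative satisfies this identity, and it agrees with g
    almost everywhere. *)
Lemma ge0_integral_density (f : T -> \bar R) :
  (forall x, 0 <= f x) -> measurable_fun setT f ->
  \int[nu]_x f x = \int[mu]_x (f x * (g x)%:E).
Proof.
move=> f0 mf; have dom := density_dominates.
have intRN := Radon_Nikodym_SigmaFinite.f_integrable dom.
rewrite -(Radon_Nikodym_SigmaFinite.change_of_variables dom)//.
apply: ae_eq_integral => //.
- by apply: emeasurable_funM => //; exact: measurable_int intRN.
- by apply: emeasurable_funM => //; exact/measurable_EFinP.
- apply: ae_eqe_mul2l; apply: density_ae_eq => //.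
  exact: Radon_Nikodym_SigmaFinite.f_integral.
Qed.

End density.

Section power_integral.
Local Open Scope ereal_scope.
Context {disp : measure_display} {T : measurableType disp} {R : realType}.
Variable mu : {sigma_finite_measure set T -> \bar R}.

Lemma integral_power0 (f : 0.-tuple T -> \bar R) :
  measurable_fun setT f -> \int[power_measure mu 0]_x f x = f [tuple].
Proof. by move=> mf; rewrite integral_dirac// diracT mul1e. Qed.

Lemma ge0_integral_powerS n (f : n.+1.-tuple T -> \bar R) :
  (forall x, 0 <= f x) -> measurable_fun setT f ->
  \int[power_measure mu n.+1]_x f x =
  \int[mu]_t \int[power_measure mu n]_x f (tcons (t, x)).
Proof.
move=> f0 mf.
rewrite [power_measure mu n.+1]/(pushforward (mu \x power_measure mu n) (@tcons _ _ n)).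
rewrite ge0_integral_pushforward//; last exact: measurable_tcons.
rewrite preimage_setT fubini_tonelli1//; last by move=> x; exact: f0.
by apply: measurableT_comp => //; exact: measurable_tcons.
Qed.

Lemma measurable_integral_tcons n (f : n.+1.-tuple T -> \bar R) :
  (forall x, 0 <= f x) -> measurable_fun setT f ->
  measurable_fun setT (fun t => \int[power_measure mu n]_x f (tcons (t, x))).
Proof.
move=> f0 mf.
apply: (@measurable_fun_fubini_tonelli_F _ _ _ _ _ (power_measure mu n)
  (f \o @tcons _ _ n)) => [|x]; last exact: f0.
by apply: measurableT_comp => //; exact: measurable_tcons.
Qed.

Lemma power_measure_forall n (B : set T) : measurable B ->
  power_measure mu n [set x | forall i, B (tnth x i)] = mu B ^+ n.
Proof.
move=> mB; elim: n => [|n IH].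
  by rewrite /= diracE mem_set// => -[].
rewrite expeS -IH.
rewrite [power_measure mu n.+1]/(pushforward (mu \x power_measure mu n) (@tcons _ _ n)).
rewrite /pushforward -product_measure1E//; last first.
  rewrite (_ : mkset _ = \bigcap_(i in [set: 'I_n]) ((@tnth _ _)^~ i @^-1` B)).
    apply: fin_bigcap_measurable => // i _.
    by rewrite -[X in measurable X]setTI; exact: measurable_tnth.
  by apply/seteqP; split => [x Bx i _|x Bx i]; exact: Bx.
congr (_ _); apply/seteqP; split => -[t x] /=.
  move=> h; split; first by have := h ord0.
  by move=> i; have := h (lift ord0 i); rewrite tnthS.
by case=> Bt Bx i; case: (unliftP ord0 i) => [j|] -> //; rewrite tnthS; exact: Bx.
Qed.

End power_integral.

(** * Shifted Gaussian vectors *)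

Section gaussian_vector.
Context {R : realType}.
Notation mu := (@lebesgue_measure R).

Definition gauss_pdf d (s : R) (a x : Rvec R d) : R :=
  \prod_(i < d) normal_pdf (tnth a i) s (tnth x i).

Lemma gauss_pdf_ge0 d s (a x : Rvec R d) : 0 <= gauss_pdf s a x.
Proof. by apply: prodr_ge0 => i _; exact: normal_pdf_ge0. Qed.

Lemma gauss_pdf_tcons d s t u (a x : Rvec R d) :
  gauss_pdf s (tcons (t, a)) (tcons (u, x)) =
  normal_pdf t s u * gauss_pdf s a x.
Proof.
rewrite /gauss_pdf big_ord_recl; congr (_ * _).
by apply: eq_bigr => i _; rewrite !tnthS.
Qed.

Lemma measurable_gauss_pdf d s (a : Rvec R d) :
  measurable_fun setT (gauss_pdf s a).
Proof.
apply: measurable_prod => i _.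
by apply: (measurableT_comp (measurable_normal_pdf _ _)); exact: measurable_tnth.
Qed.

Lemma measurable_addvl d (a : Rvec R d) : measurable_fun setT (addv a).
Proof. exact: (measurableT_comp measurable_addv (pair1_measurable a)). Qed.

Lemma addv_tcons d t u (a x : Rvec R d) :
  addv (tcons (t, a)) (tcons (u, x)) = tcons ((t : R) + (u : R) : R, addv a x).
Proof.
apply: eq_from_tnth => i; case: (unliftP ord0 i) => [j|] ->;
  by rewrite ?tnthS !tnth_mktuple ?tnthS.
Qed.

Lemma tconsE d (a : Rvec R d.+1) :
  a = tcons (thead a, [tuple of behead a]).
Proof. exact: tuple_eta. Qed.

Lemma ge0_integral_normal_shift s (a : R) (f : measurableTypeR R -> \bar R) :
  s != 0 -> (forall x, 0 <= f x)%E -> measurable_fun setT f ->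
  (\int[normal_prob 0 s]_x f (a + x)%R =
   \int[mu]_x (f x * (normal_pdf a s x)%:E))%E.
Proof.
move=> s0 f0 mf.
have mfa : measurable_fun setT (fun x => f (a + x)).
  by apply: (measurableT_comp mf) => //; exact: measurable_funD.
rewrite (ge0_integral_density (measurable_normal_pdf 0 s)
  (nu := normal_prob 0 s) (fun A _ => erefl) (fun x => f0 _) mfa).
rewrite [RHS](@ge0_integral_affine _ 1 a)//; last first.
- by move=> x _; rewrite mule_ge0// lee_fin normal_pdf_ge0.
- apply: emeasurable_funM => //; apply/measurable_EFinP.
  exact: measurable_normal_pdf.
rewrite normr1 mul1e preimage_setT; apply: eq_integral => x _.
rewrite mul1r addrC; congr (_ * EFin _)%E.
by rewrite !normal_pdfE// /normal_fun subr0 addrK.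
Qed.

(** Translation and passage to the density are treated in one statement: with
    a = 0 it says that the Gaussian vector has the product density, and the
    shift a can be peeled off one coordinate at a time in the induction on d. *)
Lemma ge0_integral_gaussian_shift d s (a : Rvec R d) (f : Rvec R d -> \bar R) :
  s != 0 -> (forall x, 0 <= f x)%E -> measurable_fun setT f ->
  (\int[gaussian_vec s]_x f (addv a x) =
   \int[lebesgue_vec]_x (f x * (gauss_pdf s a x)%:E))%E.
Proof.
rewrite /gaussian_vec /lebesgue_vec => s0.
elim: d a f => [|d IH] a f f0 mf.
  rewrite !integral_power0//.
  - by rewrite /gauss_pdf big_ord0 mule1; congr f; rewrite [LHS]tuple0.
  - apply: emeasurable_funM => //; apply/measurable_EFinP.
    exact: measurable_gauss_pdf.
  - by apply: measurableT_comp => //; exact: measurable_addvl.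
have mg : measurable_fun setT (fun x => f x * (gauss_pdf s a x)%:E)%E.
  apply: emeasurable_funM => //; apply/measurable_EFinP.
  exact: measurable_gauss_pdf.
have mfa : measurable_fun setT (fun x => f (addv a x)).
  by apply: measurableT_comp => //; exact: measurable_addvl.
rewrite !ge0_integral_powerS//; last first.
  by move=> x; rewrite mule_ge0// lee_fin gauss_pdf_ge0.
move: mg mfa; rewrite (tconsE a); set t := thead a; set b := [tuple of behead a].
move=> mg mfa.
have mft u : measurable_fun setT (fun x => f (tcons (u, x))).
  by apply: (measurableT_comp mf); apply: (measurableT_comp (@measurable_tcons _ _ d)); exact: pair1_measurable.
pose G u := (\int[power_measure mu d]_x (f (tcons (u, x)) * (gauss_pdf s b x)%:E))%E.
transitivity (\int[normal_prob 0 s]_u G (t + u)%R)%E.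
  apply: eq_integral => u _; rewrite /G -IH//.
  by apply: eq_integral => x _; rewrite addv_tcons.
have mbehead : measurable_fun setT (fun x : Rvec R d.+1 => [tuple of behead x]).
  exact: measurable_behead.
have mG : measurable_fun setT G.
  pose h (x : Rvec R d.+1) := (f x * (gauss_pdf s b [tuple of behead x])%:E)%E.
  rewrite (_ : G = fun u => \int[power_measure mu d]_x h (tcons (u, x)))%E; last first.
    apply/funext => u; apply: eq_integral => x _; congr (_ * EFin _)%E.
    by congr gauss_pdf; exact: val_inj.
  apply: measurable_integral_tcons.
    by move=> x; rewrite mule_ge0// lee_fin gauss_pdf_ge0.
  apply: emeasurable_funM => //; apply/measurable_EFinP.
  by apply: (measurableT_comp (measurable_gauss_pdf _ _)).
have G0 u : (0 <= G u)%E.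
  by apply: integral_ge0 => x _; rewrite mule_ge0// lee_fin gauss_pdf_ge0.
rewrite ge0_integral_normal_shift//; apply: eq_integral => u _.
rewrite muleC -ge0_integralZl//; last 3 first.
- apply: emeasurable_funM => //; apply/measurable_EFinP.
  exact: measurable_gauss_pdf.
- by move=> x _; rewrite mule_ge0// lee_fin gauss_pdf_ge0.
- by rewrite lee_fin normal_pdf_ge0.
apply: eq_integral => x _; rewrite gauss_pdf_tcons EFinM.
by rewrite muleCA.
Qed.

End gaussian_vector.

(** * Entropy of Gaussian mixtures as an integral *)

Section integral_mono.
Local Open Scope ereal_scope.
Context {disp : measure_display} {T : measurableType disp} {R : realType}.
Variable mu : {measure set T -> \bar R}.

(** The integral is a difference of two suprema over simple functions below the
    positive and the negative part, and these are monotone whether or not f and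
    g are measurable.  This allows one to bound the expected entropy of the
    empirical mixture without studying its measurability in the sample. *)
Lemma le_integral_mono (f g : T -> \bar R) :
  (forall x, f x <= g x) -> \int[mu]_x f x <= \int[mu]_x g x.
Proof.
have nn (u v : T -> \bar R) : (forall x, 0 <= u x) -> (forall x, u x <= v x) ->
    \int[mu]_x u x <= \int[mu]_x v x.
  move=> u0 uv; rewrite !ge0_integralTE//; last by move=> x; exact: le_trans (uv x).
  apply: ge_ereal_sup => _ [h hu <-].
  by apply: ereal_sup_ubound; exists h => // x; exact: le_trans (hu x) (uv x).
move=> fg; rewrite [leLHS]integralE [leRHS]integralE.
apply: leeB; apply: nn => // x.
- by rewrite funeposE [leRHS]funeposE ge_max !le_max fg lexx orbT.
- by rewrite funenegE [leRHS]funenegE ge_max !le_max leeN2 fg lexx orbT.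
Qed.

End integral_mono.

Section entropy_density.
Context {R : realType} {d : nat}.

(** The entropy is defined with a Radon-Nikodym derivative; any other density
    agrees with it almost everywhere. *)
Lemma entropy_density (m : {finite_measure set (Rvec R d) -> \bar R})
    (f : Rvec R d -> R) :
  measurable_fun setT f ->
  (forall A, measurable A -> m A = \int[lebesgue_vec]_(x in A) (f x)%:E)%E ->
  entropy m = (- \int[lebesgue_vec]_x (f x * ln (f x))%:E)%E.
Proof.
move=> mf mE; have dom := density_dominates mf mE.
rewrite /entropy asboolT//; congr (- _)%E.
have RNint := Radon_Nikodym_integrable (nu := charge_of_finite_measure m) dom.
have := density_ae_eq mf mE RNint.
move=> /(_ (fun A mA => Radon_Nikodym_integral (nu := charge_of_finite_measure m) dom mA)) RNf.
have mln (h : Rvec R d -> R) : measurable_fun setT h ->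
    measurable_fun setT (fun x => (h x * ln (h x))%:E).
  move=> mh; apply/measurable_EFinP; apply: measurable_funM => //.
  exact: (measurableT_comp (@measurable_ln R)).
apply: ae_eq_integral => //.
- by apply: mln; apply: measurableT_comp => //; exact: measurable_int RNint.
- exact: mln.
- by apply: filterS RNf => x /= h Tx; rewrite h.
Qed.

End entropy_density.

Section empirical_convolution.
Context {R : realType} {d : nat}.

Lemma ge0_integral_empirical n (s : n.-tuple (Rvec R d))
    (f : Rvec R d -> \bar R) :
  (forall x, 0 <= f x)%E -> measurable_fun setT f ->
  (\int[empirical s]_x f x = n%:R^-1%:E * \sum_(i < n) f (tnth s i))%E.
Proof.
move=> f0 mf.
have n0 : 0 <= n%:R^-1 :> R by rewrite invr_ge0.
pose m : {measure set (Rvec R d) -> \bar R} :=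
  mscale (NngNum n0) (msum (fun k => \d_(nth (nseq_tuple d 0%R : Rvec R d) s k)) n).
rewrite (@eq_measure_integral _ _ _ _ m); last first.
  move=> A _ _; rewrite /empirical /m /= /mscale /msum /=; congr (_ * _)%E.
  by apply: eq_bigr => i _; rewrite (tnth_nth (nseq_tuple d 0%R : Rvec R d)).
rewrite ge0_integral_mscale//=; congr (_ * _)%E.
rewrite ge0_integral_measure_sum//; apply: eq_bigr => i _.
by rewrite integral_dirac// diracT mul1e (tnth_nth (nseq_tuple d 0%R : Rvec R d)).
Qed.

Definition mixture_pdf (sigma : R) n (s : n.-tuple (Rvec R d))
    (x : Rvec R d) : R :=
  n%:R^-1 * \sum_(i < n) gauss_pdf sigma (tnth s i) x.

Lemma measurable_mixture_pdf sigma n (s : n.-tuple (Rvec R d)) :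
  measurable_fun setT (mixture_pdf sigma s).
Proof.
apply: measurable_funM => //; apply: measurable_sum => i.
exact: measurable_gauss_pdf.
Qed.

Lemma convolution_mixture_pdf sigma n (s : n.-tuple (Rvec R d)) A :
  sigma != 0 -> measurable A ->
  (convolution (empirical s) (gaussian_vec sigma) A =
   \int[lebesgue_vec]_(x in A) (mixture_pdf sigma s x)%:E)%E.
Proof.
move=> sigma0 mA.
have mpre : measurable ((fun p : Rvec R d * Rvec R d => addv p.1 p.2) @^-1` A).
  by rewrite -[X in measurable X]setTI; exact: measurable_addv.
rewrite /convolution /pushforward /product_measure1.
rewrite ge0_integral_empirical//; last exact: measurable_fun_xsection.
have mone (a : Rvec R d) : measurable_fun setT (fun x => (\1_A x * gauss_pdf sigma a x)%:E).
  apply/measurable_EFinP; apply: measurable_funM => //.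
  exact: measurable_gauss_pdf.
have one_ge0 (a x : Rvec R d) : (0 <= (\1_A x * gauss_pdf sigma a x)%:E)%E.
  by rewrite lee_fin mulr_ge0// gauss_pdf_ge0.
transitivity (n%:R^-1%:E *
    \sum_(i < n) \int[lebesgue_vec]_x (\1_A x * gauss_pdf sigma (tnth s i) x)%:E)%E.
  congr (_ * _)%E; apply: eq_bigr => i _ /=.
  under eq_integral do rewrite EFinM.
  rewrite -(@ge0_integral_gaussian_shift _ _ _ _ (fun x => (\1_A x)%:E))//.
  - rewrite (eq_integral (fun z => (\1_((addv (tnth s i)) @^-1` A) z)%:E)); last first.
      by move=> z _; rewrite !indicE.
    rewrite integral_indic//.
      rewrite setIT; congr (gaussian_vec _ _); apply/seteqP.
      by split=> z /=; rewrite /xsection/= inE.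
    by rewrite -[X in measurable X]setTI; exact: measurable_addvl.
  - exact/measurable_EFinP.
rewrite -ge0_integral_sum//.
rewrite -ge0_integralZl//; last 2 first.
- by apply: emeasurable_sum.
- by move=> x _; apply: sume_ge0.
rewrite [RHS]integral_mkcond; apply: eq_integral => x _.
rewrite patchE /mixture_pdf sumEFin -EFinM indicE.
case: (x \in A); first by under eq_bigr do rewrite mul1r.
by rewrite big1 ?mulr0// => i _; rewrite mul0r.
Qed.

Lemma entropy_mixture sigma n (s : n.-tuple (Rvec R d)) : sigma != 0 ->
  entropy (convolution (empirical s) (gaussian_vec sigma)) =
  (- \int[lebesgue_vec]_x
     (mixture_pdf sigma s x * ln (mixture_pdf sigma s x))%:E)%E.
Proof.
move=> sigma0; apply: entropy_density; first exact: measurable_mixture_pdf.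
by move=> A mA; exact: convolution_mixture_pdf.
Qed.

End empirical_convolution.

(** * Integrals of the logarithm of a Gaussian density *)

Section gauss_log.
Context {R : realType} {d : nat}.
Implicit Types (a x z : Rvec R d) (s : R).

Definition sqdist a x : R := \sum_(i < d) ((tnth x i : R) - (tnth a i : R)) ^+ 2.

Lemma sqdist_ge0 a x : 0 <= sqdist a x.
Proof. by apply: sumr_ge0 => i _; exact: sqr_ge0. Qed.

Lemma sqdist_scaled_ge0 s a x : 0 <= sqdist a x / (2 * s ^+ 2).
Proof.
by apply: divr_ge0; [exact: sqdist_ge0|rewrite mulr_ge0// sqr_ge0].
Qed.

Lemma measurable_sqdist a : measurable_fun setT (sqdist a).
Proof.
apply: measurable_sum => i; apply: measurable_funX; apply: measurable_funB => //.
exact: measurable_tnth.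
Qed.

Definition zerov : Rvec R d := [tuple (0 : R) | i < d].

Lemma add0v z : addv zerov z = z.
Proof. by apply: eq_from_tnth => i; rewrite !tnth_mktuple add0r. Qed.

Lemma sqdist_addv a z : sqdist a (addv a z) = sqdist zerov z.
Proof.
by apply: eq_bigr => i _; rewrite !tnth_mktuple subr0 addrC addKr.
Qed.

Lemma gauss_pdfE s a x : s != 0 ->
  gauss_pdf s a x = normal_peak s ^+ d * expR (- (sqdist a x / (2 * s ^+ 2))).
Proof.
move=> s0; rewrite /gauss_pdf.
under eq_bigr do rewrite normal_pdfE//.
rewrite big_split/= prodr_const card_ord; congr (_ * _).
rewrite -expR_sum; congr expR; rewrite /sqdist mulr_suml -sumrN.
by apply: eq_bigr => i _; rewrite mulNr mulr_natl.
Qed.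

Lemma gauss_pdf_gt0 s a x : s != 0 -> 0 < gauss_pdf s a x.
Proof.
by move=> s0; rewrite gauss_pdfE// mulr_gt0 ?expR_gt0// exprn_gt0// normal_peak_gt0.
Qed.

Lemma ln_gauss_pdf s a x : s != 0 ->
  ln (gauss_pdf s a x) = ln (normal_peak s ^+ d) - sqdist a x / (2 * s ^+ 2).
Proof.
move=> s0; rewrite gauss_pdfE// lnM ?expRK// posrE ?expR_gt0//.
by rewrite exprn_gt0// normal_peak_gt0.
Qed.

Lemma integrable_gauss_pdfM s a (f : Rvec R d -> R) : s != 0 ->
  (forall x, 0 <= f x) -> measurable_fun setT f ->
  (\int[gaussian_vec s]_z (f (addv a z))%:E < +oo)%E ->
  lebesgue_vec.-integrable setT (fun x => (f x * gauss_pdf s a x)%:E).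
Proof.
move=> s0 f0 mf foo; apply/integrableP; split.
  by apply/measurable_EFinP; apply: measurable_funM => //; exact: measurable_gauss_pdf.
under eq_integral do rewrite gee0_abs ?lee_fin ?mulr_ge0 ?gauss_pdf_ge0// EFinM.
rewrite -(@ge0_integral_gaussian_shift _ _ _ _ (EFin \o f))//.
exact/measurable_EFinP.
Qed.

Lemma integral_gauss_pdf s a : s != 0 ->
  (\int[lebesgue_vec]_x (gauss_pdf s a x)%:E = 1)%E.
Proof.
move=> s0; have <- : gaussian_vec s [set: Rvec R d] = 1%E by exact: probability_setT.
have := @ge0_integral_gaussian_shift _ _ s a (cst 1%E) s0.
rewrite integral_cst// mul1e => -> //.
by apply: eq_integral => x _; rewrite mul1e.
Qed.

(** Put u = |z|^2 / (2 s^2).  Since 3u/4 <= exp(3u/4), the factor u can be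
    absorbed by replacing exp(-u) with exp(-u/4), which is up to a constant the
    Gaussian density of standard deviation 2 s. *)
Lemma gauss_second_moment_lty s : s != 0 ->
  (\int[gaussian_vec s]_z (sqdist zerov z / (2 * s ^+ 2))%:E < +oo)%E.
Proof.
move=> s0; have s20 : 2 * s != 0 by rewrite mulf_neq0.
have mq : measurable_fun setT (fun z => sqdist zerov z / (2 * s ^+ 2)).
  by apply: measurable_funM => //; exact: measurable_sqdist.
have q0 z : 0 <= sqdist zerov z / (2 * s ^+ 2).
  exact: sqdist_scaled_ge0.
have := @ge0_integral_gaussian_shift _ _ s zerov
  (fun z => (sqdist zerov z / (2 * s ^+ 2))%:E) s0.
under eq_integral do rewrite add0v.
move=> ->//; last exact/measurable_EFinP.
(* C is 4/3 times the ratio of the normalising constants of the densities of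
   standard deviations s and 2 s. *)
pose C : R := 4 / 3 * (normal_peak s / normal_peak (2 * s)) ^+ d.
have C0 : 0 <= C by rewrite mulr_ge0 ?divr_ge0// exprn_ge0// divr_ge0 ?normal_peak_ge0.
apply: (@le_lt_trans _ _ (\int[lebesgue_vec]_x (C%:E * (gauss_pdf (2 * s) zerov x)%:E))%E).
  apply: le_integral_mono => x; rewrite -!EFinM lee_fin !gauss_pdfE//.
  set u := sqdist zerov x / (2 * s ^+ 2).
  rewrite (_ : sqdist zerov x / _ = u / 4); last first.
    by rewrite /u; field.
  have := @expR_ge1Dx R (3 / 4 * u).
  rewrite (_ : - (u / 4) = 3 / 4 * u + - u); last by lra.
  rewrite expRD /C expr_div_n.
  have p0 : 0 < normal_peak s ^+ d by rewrite exprn_gt0// normal_peak_gt0.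
  have p20 : 0 < normal_peak (2 * s) ^+ d by rewrite exprn_gt0// normal_peak_gt0.
  move=> h.
  rewrite [leRHS](_ : _ = (4 / 3 * expR (3 / 4 * u)) * (normal_peak s ^+ d * expR (- u)))%R; last first.
    by field; rewrite gt_eqF.
  apply: ler_wpM2r; first by rewrite mulr_ge0 ?expR_ge0// ltW.
  lra.
rewrite ge0_integralZl//; last 2 first.
- by apply/measurable_EFinP; exact: measurable_gauss_pdf.
- by move=> x _; rewrite lee_fin gauss_pdf_ge0.
by rewrite integral_gauss_pdf// mule1 ltry.
Qed.

(** Equal to d/2; it enters both entropy bounds through [gauss_entropy] and
    cancels in their difference. *)
Definition gauss_moment s : R :=
  fine (\int[gaussian_vec s]_z (sqdist zerov z / (2 * s ^+ 2))%:E)%E.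

(** Half-open, to match [normal_prob_itv]. *)
Definition box a (r : R) : set (Rvec R d) :=
  [set x | forall i, - r <= (tnth x i : R) - (tnth a i : R) < r].

Lemma measurable_box a r : measurable (box a r).
Proof.
rewrite (_ : box a r = \bigcap_(i in [set: 'I_d])
    ((fun x : Rvec R d => (tnth x i : R) - (tnth a i : R)) @^-1` `[- r, r[)); last first.
  by apply/seteqP; split => [x h i _|x h i]; have := h i; rewrite /= in_itv//=; exact.
apply: fin_bigcap_measurable => // i _.
rewrite -[X in measurable X]setTI.
apply: (_ : measurable_fun setT _) => //.
by apply: measurable_funB => //; exact: measurable_tnth.
Qed.

Lemma gaussian_box s q : 0 < s -> 0 <= q ->
  gaussian_vec s (box zerov (s * q)) = ((1 - 2 * Qfun q) ^+ d)%:E.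
Proof.
move=> s0 q0; rewrite EFin_expe -(normal_prob_itv s0 q0).
rewrite -(power_measure_forall (normal_prob 0 s)); last by [].
congr (gaussian_vec _ _); apply/seteqP; split => x /= h i;
  by have := h i; rewrite in_itv/= tnth_mktuple subr0.
Qed.

(** The integrand is a combination of p, |x - a|^2 p and 1_box p, with p the
    density centred at a.  By translation, none of the three integrals depends
    on a. *)
Lemma integral_gauss_ln s q a (c c' : R) : 0 < s -> 0 <= q ->
  let u x := (gauss_pdf s a x *
     (ln (gauss_pdf s a x) - c - c' * \1_(box a (s * q)) x))%:E in
  lebesgue_vec.-integrable setT u /\
  (\int[lebesgue_vec]_x u x =
   (ln (normal_peak s ^+ d) - gauss_moment s - c
     - c' * (1 - 2 * Qfun q) ^+ d)%:E)%E.
Proof.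
move=> s_gt0 q0 u; have s0 : s != 0 by rewrite gt_eqF.
set B := box a (s * q).
have mB : measurable B by exact: measurable_box.
pose u1 x : R := (ln (normal_peak s ^+ d) - c) * gauss_pdf s a x.
pose u2 x : R := sqdist a x / (2 * s ^+ 2) * gauss_pdf s a x.
pose u3 x : R := \1_B x * gauss_pdf s a x.
have int_pdf : lebesgue_vec.-integrable setT (fun x => (gauss_pdf s a x)%:E).
  apply/integrableP; split; first by apply/measurable_EFinP; exact: measurable_gauss_pdf.
  under eq_integral do rewrite gee0_abs ?lee_fin ?gauss_pdf_ge0//.
  by rewrite integral_gauss_pdf// ltry.
have int1 : lebesgue_vec.-integrable setT (fun x => (u1 x)%:E).
  by under eq_fun do rewrite /u1 EFinM; exact: integrableZl.
have mq : measurable_fun setT (fun z => sqdist a z / (2 * s ^+ 2)).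
  by apply: measurable_funM => //; exact: measurable_sqdist.
have qge0 z : 0 <= sqdist a z / (2 * s ^+ 2).
  exact: sqdist_scaled_ge0.
have moment : (\int[gaussian_vec s]_z (sqdist a (addv a z) / (2 * s ^+ 2))%:E =
    (gauss_moment s)%:E)%E.
  under eq_integral do rewrite sqdist_addv.
  rewrite /gauss_moment fineK// ge0_fin_numE ?gauss_second_moment_lty//.
  by apply: integral_ge0 => z _; rewrite lee_fin sqdist_scaled_ge0.
have int2 : lebesgue_vec.-integrable setT (fun x => (u2 x)%:E).
  by apply: integrable_gauss_pdfM => //; rewrite moment ltry.
have val2 : (\int[lebesgue_vec]_x (u2 x)%:E = (gauss_moment s)%:E)%E.
  rewrite -moment (@ge0_integral_gaussian_shift _ _ _ _ (fun z => (sqdist a z / (2 * s ^+ 2))%:E))//.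
  exact/measurable_EFinP.
have m1B : measurable_fun setT (\1_B : Rvec R d -> R) by [].
have boxval : (\int[gaussian_vec s]_z (\1_B (addv a z))%:E =
    ((1 - 2 * Qfun q) ^+ d)%:E)%E.
  rewrite -(gaussian_box s_gt0 q0) -(setIT (box _ _)).
  rewrite -(integral_indic (gaussian_vec s))//; last exact: measurable_box.
  apply: eq_integral => z _; rewrite !indicE; congr ((nat_of_bool _)%:R%:E).
  apply/idP/idP; rewrite !inE /B /box/= => h i; have := h i;
    by rewrite !tnth_mktuple subr0 addrC addKr.
have int3 : lebesgue_vec.-integrable setT (fun x => (u3 x)%:E).
  by apply: integrable_gauss_pdfM => //; rewrite boxval ltry.
have val3 : (\int[lebesgue_vec]_x (u3 x)%:E = ((1 - 2 * Qfun q) ^+ d)%:E)%E.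
  rewrite -boxval (@ge0_integral_gaussian_shift _ _ _ _ (fun z => (\1_B z)%:E))//.
  exact/measurable_EFinP.
have int3' : lebesgue_vec.-integrable setT (fun x => c'%:E * (u3 x)%:E)%E.
  exact: integrableZl.
have uE : u = (fun x => ((u1 x)%:E - (u2 x)%:E) - c'%:E * (u3 x)%:E)%E.
  apply/funext => x; rewrite /u -EFinM -!EFinB /u1 /u2 /u3 ln_gauss_pdf//.
  by congr EFin; ring.
have int12 : lebesgue_vec.-integrable setT (fun x => (u1 x)%:E - (u2 x)%:E)%E.
  exact: integrableB.
rewrite uE; split; first exact: integrableB.
rewrite integralB// integralB// integralZl// val2 val3.
under eq_integral do rewrite /u1 EFinM.
rewrite integralZl// integral_gauss_pdf// mule1 -EFinM -!EFinB; congr EFin; ring.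
Qed.

End gauss_log.

(** * Entropy bounds for Gaussian mixtures *)

Section mean_xlnx.
Context {R : realType} {n : nat}.
Variable p : 'I_n -> R.
Hypothesis n_gt0 : (0 < n)%N.
Hypothesis p_gt0 : forall i, 0 < p i.
Let f := n%:R^-1 * \sum_(i < n) p i.

Let n0 : 0 < n%:R :> R. Proof. by rewrite ltr0n. Qed.

Let f_gt0 : 0 < f.
Proof.
rewrite mulr_gt0 ?invr_gt0// (bigD1 (Ordinal n_gt0))//= ltr_pwDl//.
by apply: sumr_ge0 => i _; exact: ltW.
Qed.

(** A log-sum inequality: from ln y <= y - 1 at y = n a_i f / p_i, the i-th term
    of the difference is at least p_i - n a_i f, and these bounds add up to
    n f (1 - sum_i a_i) >= 0. *)
Lemma mean_xlnx_le (a : 'I_n -> R) :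
  (forall i, 0 < a i) -> \sum_(i < n) a i <= 1 ->
  f * ln f <= n%:R^-1 * \sum_(i < n) p i * (ln (p i) - ln (n%:R * a i)).
Proof.
move=> a_gt0 sum_a.
rewrite {1}/f -mulrA ler_pM2l ?invr_gt0// mulr_suml -subr_ge0 -sumrB.
have nf : n%:R * f = \sum_(i < n) p i by rewrite /f mulrA divff ?mul1r// gt_eqF.
apply: (@le_trans _ _ (\sum_(i < n) (p i - n%:R * f * a i))).
  by rewrite sumrB -mulr_sumr -nf subr_ge0 ler_piMr// mulr_ge0// ltW.
apply: ler_sum => i _.
have na0 : 0 < n%:R * a i by rewrite mulr_gt0.
have naf0 : 0 < n%:R * a i * f by exact: mulr_gt0.
have y0 : 0 < n%:R * a i * f / p i by exact: divr_gt0.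
have := @le_ln1Dx R (n%:R * a i * f / p i - 1).
rewrite ltrBrDr addNr => /(_ y0).
rewrite (_ : 1 + _ = n%:R * a i * f / p i); last by ring.
have -> : ln (n%:R * a i * f / p i) = ln (n%:R * a i) + ln f - ln (p i).
  by rewrite ln_div ?posrE// lnM.
move=> h.
rewrite -mulrBr (_ : p i - _ = p i * (1 - n%:R * a i * f / p i)); last first.
  by field; rewrite gt_eqF.
rewrite ler_pM2l//; lra.
Qed.

(** Each p_i / n is at most f. *)
Lemma mean_xlnx_ge :
  n%:R^-1 * \sum_(i < n) p i * (ln (p i) - ln n%:R) <= f * ln f.
Proof.
rewrite {1}/f -[leRHS]mulrA ler_pM2l ?invr_gt0// mulr_suml.
apply: ler_sum => i _; rewrite ler_pM2l// -ln_div ?posrE//.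
rewrite ler_ln ?posrE ?divr_gt0// mulrC /f ler_pM2l ?invr_gt0//.
by rewrite (bigD1 i)//= lerDl sumr_ge0// => j _; exact: ltW.
Qed.

End mean_xlnx.

Section mixture_entropy.
Context {R : realType} {d : nat}.
Variable sigma : R.
Hypothesis sigma_gt0 : 0 < sigma.
Let sigma0 : sigma != 0. Proof. by rewrite gt_eqF. Qed.

(** The differential entropy of the centred Gaussian vector, as
    - ln p(z) = |z|^2 / (2 sigma^2) - ln (normal_peak sigma ^+ d). *)
Definition gauss_entropy : R :=
  gauss_moment (d := d) sigma - ln (normal_peak sigma ^+ d).

Lemma integral_mean n (u : 'I_n -> Rvec R d -> R) (v : R) : (0 < n)%N ->
  (forall i, lebesgue_vec.-integrable setT (EFin \o u i) /\
    (\int[lebesgue_vec]_x (u i x)%:E = v%:E)%E) ->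
  (\int[lebesgue_vec]_x (n%:R^-1 * \sum_(i < n) u i x)%:E = v%:E)%E.
Proof.
move=> n0 h.
have hint i : lebesgue_vec.-integrable setT (fun x => (u i x)%:E) by case: (h i).
have hval i : (\int[lebesgue_vec]_x (u i x)%:E = v%:E)%E by case: (h i).
under eq_integral do rewrite EFinM -sumEFin.
rewrite integralZl//; last by apply: integrable_sum => // i _; exact: hint.
rewrite integral_sum//; under eq_bigr do rewrite hval.
rewrite sumEFin -EFinM sumr_const card_ord -(mulr_natl v) mulrA mulVf ?mul1r//.
by rewrite pnatr_eq0 -lt0n.
Qed.

(** Integrate [mean_xlnx_ge]; [integral_gauss_ln] is used without its indicator,
    i.e. with c' = 0. *)
Lemma entropy_mixture_le n (s : n.-tuple (Rvec R d)) : (0 < n)%N ->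
  (entropy (convolution (empirical s) (gaussian_vec sigma)) <=
   (gauss_entropy + ln n%:R)%:E)%E.
Proof.
move=> n0; rewrite entropy_mixture// leeNl.
have u_ i := @integral_gauss_ln R d sigma 0 (tnth s i) (ln n%:R) 0 sigma_gt0 (lexx _).
rewrite -EFinN (_ : - _ = ln (normal_peak sigma ^+ d) -
  gauss_moment (d := d) sigma - ln n%:R -
  0 * (1 - 2 * Qfun 0) ^+ d); last by rewrite /gauss_entropy; ring.
rewrite -(integral_mean n0 u_).
apply: le_integral_mono => x; rewrite lee_fin.
apply: le_trans (mean_xlnx_ge n0 _); last by move=> i; exact: gauss_pdf_gt0.
rewrite ler_pM2l ?invr_gt0 ?ltr0n//; apply: ler_sum => i _.
by rewrite mul0r subr0.
Qed.

(** Fano's inequality for the decoder that returns the index of the box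
    containing the observation: integrate [mean_xlnx_le], where a_i is the
    weight 1 - eps on the i-th box and eps / n off it.  At most one box contains
    a given point, so the weights add up to at most eps + (1 - eps). *)
Lemma entropy_mixture_ge n (s : n.-tuple (Rvec R d)) (q eps : R) : (0 < n)%N ->
  0 <= q -> 0 < eps < 1 -> (1 - 2 * Qfun q) ^+ d = 1 - eps ->
  (forall i j x, box (tnth s i) (sigma * q) x ->
    box (tnth s j) (sigma * q) x -> i = j) ->
  ((gauss_entropy + (1 - eps) * ln n%:R - binary_entropy eps)%:E <=
   entropy (convolution (empirical s) (gaussian_vec sigma)))%E.
Proof.
move=> n0 q0 /andP[e0 e1] qeps disj; rewrite entropy_mixture// leeNr.
have nR : 0 < n%:R :> R by rewrite ltr0n.
have e1' : 0 < 1 - eps by lra.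
(* ln (n a_i) equals ln eps off the i-th box and ln eps + c' on it. *)
pose c' := ln (n%:R * (1 - eps)) - ln eps.
have u_ i := @integral_gauss_ln R d sigma q (tnth s i) (ln eps) c' sigma_gt0 q0.
rewrite -EFinN (_ : - (_ + _ - _) = ln (normal_peak sigma ^+ d) -
  gauss_moment (d := d) sigma - ln eps -
  c' * (1 - 2 * Qfun q) ^+ d); last first.
  by rewrite qeps /gauss_entropy /c' /binary_entropy lnM ?posrE//; ring.
rewrite -(integral_mean n0 u_).
apply: le_integral_mono => x; rewrite lee_fin.
pose b i : R := \1_(box (tnth s i) (sigma * q)) x.
pose a i := eps / n%:R +
  (if x \in box (tnth s i) (sigma * q) then 1 - eps - eps / n%:R else 0).
have an i : ln (n%:R * a i) = ln eps + c' * b i.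
  rewrite /a /b indicE; case: ifPn => _ /=.
    by rewrite subrKC mulr1 /c' subrKC.
  by rewrite mulr0 !addr0 mulrC divfK// gt_eqF.
have a_gt0 i : 0 < a i.
  by rewrite /a; case: ifPn => _; [rewrite subrKC | rewrite addr0 divr_gt0].
have ab i : a i <= eps / n%:R + (1 - eps) * b i.
  rewrite /a /b indicE lerD2l; case: ifPn => _ /=; last by rewrite mulr0.
  by rewrite mulr1 lerBlDr lerDl divr_ge0// ltW.
have sum_b : \sum_(i < n) b i <= 1.
  have [[i xi]|none] := pselect (exists i, box (tnth s i) (sigma * q) x).
    rewrite (bigD1 i)//= big1 ?addr0; first by rewrite /b indicE; case: (_ \in _).
    move=> j ji; rewrite /b indicE memNset// => xj.
    by move/eqP : ji; apply; exact: disj xj xi.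
  rewrite big1// => i _; rewrite /b indicE memNset// => xi; apply: none.
  by exists i.
have sum_a : \sum_(i < n) a i <= 1.
  apply: (@le_trans _ _ (\sum_(i < n) (eps / n%:R + (1 - eps) * b i))).
    by apply: ler_sum => i _; exact: ab.
  rewrite big_split/= sumr_const card_ord -(mulr_natr (eps / _)) divfK ?gt_eqF// -mulr_sumr.
  apply: (@le_trans _ _ (eps + (1 - eps) * 1)); last by lra.
  by rewrite lerD2l ler_pM2l.
apply: (le_trans (mean_xlnx_le n0 (fun i => gauss_pdf_gt0 _ _ sigma0) a_gt0 sum_a)).
rewrite ler_pM2l ?invr_gt0//; apply: ler_sum => i _.
by rewrite an opprD addrA.
Qed.

End mixture_entropy.

(** * The uniform distribution on a grid, and the lower bound on the bias *)

Section grid.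
Context {R : realType} {d k : nat}.
Hypothesis k_gt0 : (0 < k)%N.

Let k0 : 0 < k%:R :> R. Proof. by rewrite ltr0n. Qed.

Definition grid_point (t : d.-tuple 'I_k) : Rvec R d :=
  [tuple (-1 + (2 * (tnth t i)%:R + 1) / k%:R : R) | i < d].

Definition grid : #|{: d.-tuple 'I_k}|.-tuple (Rvec R d) :=
  [tuple grid_point (enum_val i) | i < #|{: d.-tuple 'I_k}|].

Lemma grid_point_itv t i : -1 <= (tnth (grid_point t) i : R) <= 1.
Proof.
rewrite tnth_mktuple lerDl divr_ge0//= ?addr_ge0// ?mulr_ge0//.
rewrite -lerBrDl ler_pdivrMr// opprK.
have : ((tnth t i).+1%:R <= k%:R :> R) by rewrite ler_nat.
rewrite -natr1; lra.
Qed.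

(** Two centres that share a point in their boxes differ by less than 2 r <= 2/k
    in every coordinate, while distinct coordinates differ by at least 2/k. *)
Lemma grid_disjoint r (i j : 'I_#|{: d.-tuple 'I_k}|) x : r <= k%:R^-1 ->
  box (tnth grid i) r x -> box (tnth grid j) r x -> i = j.
Proof.
move=> rk; rewrite !tnth_mktuple => xi xj; apply: enum_val_inj.
apply: eq_from_tnth => l; apply/val_inj => /=.
have := xi l; have := xj l; rewrite !tnth_mktuple.
set u := tnth (enum_val i) l; set v := tnth (enum_val j) l; set y := tnth x l.
move=> /andP[v1 v2] /andP[u1 u2].
have uv : `|u%:R - v%:R| < 1 :> R.
  have : (2 * u%:R + 1) / k%:R - (2 * v%:R + 1) / k%:R < 2 / k%:R :> R by lra.
  have : (2 * v%:R + 1) / k%:R - (2 * u%:R + 1) / k%:R < 2 / k%:R :> R by lra.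
  rewrite -!mulrBl !ltr_pM2r ?invr_gt0// ltr_norml => h1 h2; apply/andP; split; lra.
have uv1 : u%:R < v.+1%:R :> R by rewrite -natr1; move: uv; rewrite ltr_norml => /andP[]; lra.
have vu1 : v%:R < u.+1%:R :> R by rewrite -natr1; move: uv; rewrite ltr_norml => /andP[]; lra.
by move: uv1 vu1; rewrite !ltr_nat !ltnS => h1 h2; apply/eqP; rewrite eqn_leq h1.
Qed.

Lemma card_grid : #|{: d.-tuple 'I_k}| = (k ^ d)%N.
Proof. by rewrite card_tuple card_ord. Qed.

End grid.

Section empirical_probability.
Context {R : realType} {d : nat}.

Lemma empirical_probability n (s : n.-tuple (Rvec R d)) : (0 < n)%N ->
  exists P : probability (Rvec R d) R, P = empirical s :> (set _ -> \bar R).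
Proof.
move=> n0.
have s1 : empirical s setT = 1%E.
  rewrite /empirical; under eq_bigr do rewrite diracT.
  rewrite sumEFin -EFinM sumr_const card_ord mulVf//.
  by rewrite pnatr_eq0 -lt0n.
pose m : {measure set (Rvec R d) -> \bar R} := empirical s.
pose build := Measure_isProbability.Build _ _ _ (m : set _ -> _) s1.
pose P : probability (Rvec R d) R := HB.pack (Measure.sort m) (Measure.class m) build.
by exists P.
Qed.

(** A point outside the closed cube has a coordinate at positive distance r from
    [-1, 1], and its sup-norm ball of radius r contains no point of s. *)
Lemma supp_empirical n (s : n.-tuple (Rvec R d)) :
  (forall i, unit_cube (tnth s i)) -> supp (empirical s) `<=` unit_cube.
Proof.
move=> scube x xsupp l; apply/negPn/negP => xl.
have [r r0 far] : exists2 r : R, 0 < r &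
    forall y : R, -1 <= y <= 1 -> r <= `|y - (tnth x l : R)|.
  move: xl; rewrite negb_and -!ltNge => /orP[h|h].
    exists (-1 - (tnth x l : R)); first by lra.
    move=> y /andP[y1 y2]; apply: le_trans (ler_norm _); lra.
  exists ((tnth x l : R) - 1); first by lra.
  move=> y /andP[y1 y2]; rewrite distrC; apply: le_trans (ler_norm _); lra.
have := xsupp r r0; rewrite /empirical big1 ?mule0 ?ltxx// => i _.
rewrite diracE memNset// => /(_ l).
by rewrite ltNge far//; exact: scube.
Qed.

End empirical_probability.

Section bias_bound.
Context {R : realType} {d : nat}.

(** Take for P the uniform distribution on the grid.  Since it is an empirical
    measure, the density formula for Gaussian mixtures covers both entropies
    that occur in the bias. *)
Lemma sup_bias_ge (sigma q eps : R) (k n : nat) : 0 < sigma -> 0 <= q ->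
  0 < eps < 1 -> (1 - 2 * Qfun q) ^+ d = 1 - eps ->
  (0 < k)%N -> sigma * q <= k%:R^-1 -> (0 < n)%N ->
  (((1 - eps) * ln (k ^ d)%:R - binary_entropy eps - ln n%:R)%:E
     <= sup_bias d sigma n)%E.
Proof.
move=> sigma0 q0 eps01 qeps k0 sqk n0.
have sigma_neq0 : sigma != 0 by rewrite gt_eqF.
have M0 : (0 < #|{: d.-tuple 'I_k}|)%N by rewrite card_grid expn_gt0 k0.
pose s := @grid R d k.
have [P PE] := empirical_probability s M0.
have entropyP : entropy (convolution P (gaussian_vec sigma)) =
    entropy (convolution (empirical s) (gaussian_vec sigma)).
  rewrite [RHS]entropy_mixture//.
  apply: entropy_density; first exact: measurable_mixture_pdf.
  by move=> A mA; rewrite /= PE; exact: convolution_mixture_pdf.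
apply: (@le_trans _ _ `|bias sigma n P|%E); last first.
  rewrite /sup_bias; apply: ereal_sup_ubound; exists P; last by [].
  rewrite /mkset PE; apply: supp_empirical => i l.
  by rewrite tnth_mktuple; exact: grid_point_itv.
apply: le_trans (lee_abs _); rewrite /bias entropyP.
have lower := @entropy_mixture_ge R d sigma sigma0 _ s q eps M0 q0 eps01 qeps
  (fun i j x => grid_disjoint k0 sqk).
have upper : (\int[power_measure P n]_t entropy (convolution (empirical t) (gaussian_vec sigma))
    <= (gauss_entropy (d := d) sigma + ln n%:R)%:E)%E.
  pose c : \bar R := (gauss_entropy (d := d) sigma + ln n%:R)%:E.
  apply: (@le_trans _ _ (\int[power_measure P n]_t (cst c t))%E).
    by apply: le_integral_mono => t; exact: entropy_mixture_le.
  rewrite (integral_cst (power_measure P n) measurableT).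
  have P1 := probability_setT (power_measure P n).
  rewrite [X in (_ * X)%E](_ : _ = 1%E); first by rewrite mule1.
  exact: P1.
apply: le_trans (leeB lower upper).
by rewrite card_grid -EFinB lee_fin; lra.
Qed.

End bias_bound.

Theorem theorem4 (R : realType) (d : nat) (sigma eps : R)
    (d_ge1 : (1 <= d)%N) (sigma_gt0 : 0 < sigma)
    (eps_gt : 1 - (1 - 2 * Qfun (1 / (2 * sigma))) ^+ d < eps)
    (eps_lt1 : eps < 1) :
  let k := kstar d sigma eps in
  [/\ (2 <= k)%R,
      forall n : nat, (1 <= n)%N ->
        ((ln ((k%:~R : R) `^ (d%:R * (1 - eps)) / n%:R)
            - binary_entropy eps)%:E
          <= sup_bias d sigma n)%E &
      forall delta : R, 0 < delta ->
        forall n : nat, (1 <= n)%N ->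
          n%:R <= (k%:~R : R) `^ (d%:R * (1 - eps))
                    * expR (- (delta + binary_entropy eps)) ->
          (delta%:E <= sup_bias d sigma n)%E].
Proof.
move=> k.
pose y : R := 1 / (2 * sigma).
pose root : R := (1 - eps) `^ d%:R^-1.
pose p : R := 2^-1 * (1 - root).
pose q : R := Qinv p.
have y0 : 0 <= y by rewrite divr_ge0// mulr_ge0// ltW.
have Qy_ge0 : 0 <= Qfun y := Qfun_ge0 y.
have Qy_le : Qfun y <= 2^-1 by rewrite -Qfun0; exact: Qfun_nincr.
have eps_gt0 : 0 < eps.
  apply: le_lt_trans eps_gt; rewrite subr_ge0 exprn_ile1//; rewrite -/y; lra.
have root_gt0 : 0 < root by rewrite powR_gt0// subr_gt0.
have d0 : d%:R != 0 :> R by rewrite pnatr_eq0 -lt0n.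
have rootd : root ^+ d = 1 - eps.
  by rewrite -powR_mulrn ?powR_ge0// -powRrM mulVf// powRr1// subr_ge0 ltW.
have root_lt : root < 1 - 2 * Qfun y.
  rewrite ltNge; apply/negP => h.
  have : (1 - 2 * Qfun y) ^+ d <= root ^+ d.
    by apply: lerXn2r => //; rewrite nnegrE; lra.
  rewrite rootd; move: eps_gt; rewrite -/y; lra.
have Qq : Qfun q = p by apply: (@QinvK _ p y) => //; rewrite /p; lra.
have q_gt0 : 0 < q.
  rewrite ltNge; apply/negP => /Qfun_nincr; rewrite Qfun0 Qq /p; lra.
have q_lt : q < y.
  rewrite ltNge; apply/negP => /Qfun_nincr; rewrite Qq /p; lra.
have sq_gt0 : 0 < sigma * q by rewrite mulr_gt0.
have sq_lt : 2 < (sigma * q)^-1.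
  rewrite -[ltLHS]invrK ltf_pV2 ?posrE ?invr_gt0//.
  move: q_lt; rewrite /y -(ltr_pM2l sigma_gt0) => /lt_le_trans; apply.
  by rewrite le_eqVlt; apply/orP; left; apply/eqP; field; rewrite gt_eqF.
have k2 : 2 <= k by rewrite /k /kstar -/root -/p -/q floor_ge_int; exact: ltW.
have kE : k = `|k|%N :> int by rewrite gez0_abs// (le_trans _ k2).
have kR : k%:~R = `|k|%N%:R :> R by rewrite [in LHS]kE.
have nk0 : (0 < `|k|)%N by rewrite -ltz_nat -kE (lt_le_trans _ k2).
have k0 : 0 < `|k|%N%:R :> R by rewrite ltr0n.
have sqk : sigma * q <= `|k|%N%:R^-1.
  rewrite -[leLHS]invrK lef_pV2 ?posrE ?invr_gt0// -kR; exact: floor_le.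
have bound n : (1 <= n)%N ->
    ((ln ((k%:~R : R) `^ (d%:R * (1 - eps)) / n%:R) - binary_entropy eps)%:E
      <= sup_bias d sigma n)%E.
  move=> n1; have eps01 : 0 < eps < 1 by rewrite eps_gt0.
  have qeps : (1 - 2 * Qfun q) ^+ d = 1 - eps.
    by rewrite Qq -rootd /p; congr (_ ^+ _); lra.
  apply: le_trans (sup_bias_ge sigma_gt0 (ltW q_gt0) eps01 qeps nk0 sqk n1).
  rewrite lee_fin kR ln_div ?posrE ?powR_gt0 ?ltr0n// ln_powR natrX lnXn//.
  by rewrite -mulr_natl; lra.
split => // delta delta0 n n1 nle.
apply: le_trans (bound n n1); rewrite lee_fin.
have n0 : 0 < n%:R :> R by rewrite ltr0n.
rewrite lerBrDr -[leLHS]expRK ler_ln ?posrE ?expR_gt0 ?divr_gt0 ?powR_gt0 ?kR//.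
rewrite ler_pdivlMr// mulrC -ler_pdivlMr ?expR_gt0// -expRN -kR.
exact: nle.
Qed.
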